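(* Let $U=SC$ be the quantum walk on the half line with coins $C_j$ determined by parameters $\eta_j\in\mathbb{C}$ with $|\eta_j|\le 1$ and $\mathrm{Im}(\eta_j)=\kappa$ for all $j\ge 0$, and let $\phi=\arccos\kappa\in[0,\pi]$. If the underlying random walk $P$ is positive recurrent, then the $(-ie^{i\phi})$-eigenspace of $U$ exists, and $$\ker(-ie^{i\phi}-U)=\mathbb{C}\{Km_V\}=\mathbb{C}\{\psi_*\},$$ where $\psi_*(0;L)=1$ and $$\psi_*(j;R)=\psi_*(j+1;L)=\sqrt{\frac{p_0\cdots p_j}{q_0\cdots q_j}}\qquad (j\ge 0).$$
   Context: Graph: the half line with vertex set $\mathbb{Z}_+=\{0,1,2,\dots\}$, edges $\{j,j+1\}$, and one self loop at $0$. The arc set $A$ consists of, for each $j\ge 0$, the arc $(j;R)$ with terminus $j$ and origin $j+1$, the arc $(j+1;L)$ with terminus $j+1$ and origin $j$, and the self loop $(0;L)$. Inverse arcs: $\overline{(j;R)}=(j+1;L)$, $\overline{(j+1;L)}=(j;R)$, $\overline{(0;L)}=(0;L)$. The flip-flop shift on $\ell^2(A)$ is $(S\psi)(a)=\psi(\bar a)$. Coin: $C=\bigoplus_{j\ge0}C_j$, where $C_j$ acts on functions supported on the two arcs with terminus $j$; in the ordered basis $((j;R),(j;L))$, $$C_j=\begin{bmatrix}-\eta_j&\rho_j\\ \rho_j&\bar\eta_j\end{bmatrix},\qquad \rho_j=\sqrt{1-|\eta_j|^2}.$$ It is assumed that $\mathrm{Im}(\eta_j)=\kappa$ is independent of $j$,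 and that the coins have two distinct eigenvalues (so $\kappa\ne\pm1$). Then $\mathrm{Spec}(C_j)=\{-ie^{\pm i\phi}\}$ with $\cos\phi=\kappa$, $e^{i\phi}=\kappa+i\sqrt{1-\kappa^2}$, and $\ker(C_j+ie^{i\phi})=\mathbb{C}\,[\sqrt{p_j}\ \sqrt{q_j}]^\top$, where $$p_j=\tfrac12\Bigl(1-\tfrac{\mathrm{Re}(\eta_j)}{\sqrt{1-\kappa^2}}\Bigr),\qquad q_j=\tfrac12\Bigl(1+\tfrac{\mathrm{Re}(\eta_j)}{\sqrt{1-\kappa^2}}\Bigr).$$ The quantum walk is $U=SC$ on $\ell^2(A)$. Underlying random walk $P$: the Markov chain on $\mathbb{Z}_+$ that from $j\ge1$ moves to $j+1$ with probability $p_j$ and to $j-1$ with probability $q_j$, and from $0$ moves to $1$ with probability $p_0$ and stays at $0$ with probability $q_0$. It is positive recurrent if the return time to a state is almost surely finite with finite expectation. The map $K:\ell^2(\mathbb{Z}_+)\to\ell^2(A)$ is $(Kf)(j;R)=\sqrt{p_j}f(j)$, $(Kf)(j;L)=\sqrt{q_j}f(j)$. The function $m_V$ on $\mathbb{Z}_+$ (defined up to a nonzero scalar) is $m_V(j)/m_V(0)=\sqrt{\dfrac{p_0\cdots p_{j-1}}{q_1\cdots q_j}}$.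
   Formalization: Since |η_j|=1 is allowed, some q_j can vanish and the formulas for m_V and ψ_* then divide by zero; it is assumed that q_j≠0 for j≥1, and q_0≠0 for the equality with ℂ{ψ_*} only. Positive recurrence is required of every state. *)

(* Defs.v *)
From HB Require Import structures.
From mathcomp Require Import all_boot all_order all_algebra.
From mathcomp Require Import all_classical all_reals all_analysis.
From mathcomp Require Import complex.

Set Implicit Arguments.
Unset Strict Implicit.
Unset Printing Implicit Defensive.

Import Order.TTheory GRing.Theory Num.Theory.
Local Open Scope classical_set_scope.
Local Open Scope ring_scope.
Local Open Scope complex_scope.

(* [ArcR j] is the arc (j;R) and [ArcL j] the arc (j;L): an arc is determined
   by its terminus j and its label. *)
Inductive arc := ArcR of nat | ArcL of nat.

Definition arc_code (a : arc) : nat + nat :=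
  match a with ArcR j => inl j | ArcL j => inr j end.

Definition arc_decode (s : nat + nat) : arc :=
  match s with inl j => ArcR j | inr j => ArcL j end.

Lemma arc_codeK : cancel arc_code arc_decode.
Proof. by case. Qed.

HB.instance Definition _ := Countable.copy arc (can_type arc_codeK).

(* [ArcL 0] is the self loop at 0, which is its own inverse. *)
Definition inv_arc (a : arc) : arc :=
  match a with
  | ArcR j => ArcL j.+1
  | ArcL j.+1 => ArcR j
  | ArcL 0 => ArcL 0
  end.

Section QuantumWalk.
Variable R : realType.
Local Notation C := R[i].

Definition modulus (z : C) : R := Num.sqrt (complex.Re z ^+ 2 + complex.Im z ^+ 2).

(* l^2(I), as the set of square summable functions *)
Definition l2 (I : choiceType) : set (I -> C) :=
  [set f | (\esum_(i in [set: I]) (modulus (f i) ^+ 2)%:E < +oo)%E].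

Definition shift (psi : arc -> C) : arc -> C := fun a => psi (inv_arc a).

Definition rho (eta : nat -> C) (j : nat) : R :=
  Num.sqrt (1 - modulus (eta j) ^+ 2).

(* [coin eta] applies to (psi (j;R), psi (j;L)), for each j, the matrix
     [ - eta_j     rho_j    ]
     [   rho_j   eta_j ^*   ]. *)
Definition coin (eta : nat -> C) (psi : arc -> C) : arc -> C := fun a =>
  match a with
  | ArcR j => - eta j * psi (ArcR j) + (rho eta j)%:C * psi (ArcL j)
  | ArcL j => (rho eta j)%:C * psi (ArcR j) + (eta j)^* * psi (ArcL j)
  end.

Definition walk (eta : nat -> C) (psi : arc -> C) : arc -> C :=
  shift (coin eta psi).

(* ker (z - U) for the operator U = walk eta on l^2(A) *)
Definition walk_ker (eta : nat -> C) (z : C) : set (arc -> C) :=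
  [set psi : arc -> C | l2 psi /\ forall a, z * psi a - walk eta psi a = 0].

Definition line (v : arc -> C) : set (arc -> C) :=
  [set (fun a => c * v a) | c in [set: C]].

Definition expi (t : R) : C := cos t +i* sin t.

Definition prob_p (kappa : R) (eta : nat -> C) (j : nat) : R :=
  (1 - complex.Re (eta j) / Num.sqrt (1 - kappa ^+ 2)) / 2.

Definition prob_q (kappa : R) (eta : nat -> C) (j : nat) : R :=
  (1 + complex.Re (eta j) / Num.sqrt (1 - kappa ^+ 2)) / 2.

(* For j = 0 the predecessor j.-1 is 0: from 0 the chain stays put with
   probability q 0. *)
Definition half_line_trans (p q : nat -> R) (j k : nat) : R :=
  if k == j.+1 then p j else if k == j.-1 then q j else 0.

(* X is a Markov chain on nat started at x0 with transition probabilities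
   trans; the Markov property
     Pr(X_(n+1) = y | X_0 = x_0, ..., X_n = x_n) = trans x_n y
   is stated without division, hence also for null pasts. *)
Definition is_markov_chain (trans : nat -> nat -> R) (x0 : nat)
    (d : measure_display) (T : measurableType d) (Pr : probability T R)
    (X : nat -> T -> nat) : Prop :=
  [/\ forall n, measurable_fun [set: T] (X n),
      Pr [set w | X 0%N w = x0] = 1%E
    & forall (n : nat) (x : nat -> nat) (y : nat),
        Pr [set w | (forall i, (i <= n)%N -> X i w = x i) /\ X n.+1 w = y] =
        (Pr [set w | forall i, (i <= n)%N -> X i w = x i]
          * (trans (x n) y)%:E)%E].

(* inf {n >= 1 | X_n = j}, equal to +oo when j is never visited *)
Definition return_time (T : Type) (X : nat -> T -> nat) (j : nat) (w : T)
    : \bar R :=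
  ereal_inf [set n%:R%:E | n in [set n : nat | (0 < n)%N /\ X n w = j]].

(* The law of a chain is determined by its initial state and transition
   probabilities, so the choice of the realization X is immaterial. *)
Definition positive_recurrent_at (trans : nat -> nat -> R) (j : nat) : Prop :=
  exists (d : measure_display) (T : measurableType d) (Pr : probability T R)
         (X : nat -> T -> nat),
    [/\ is_markov_chain trans j Pr X,
        {ae Pr, forall w, (return_time X j w < +oo)%E}
      & (\int[Pr]_w return_time X j w < +oo)%E].

Definition positive_recurrent (trans : nat -> nat -> R) : Prop :=
  forall j, positive_recurrent_at trans j.

Definition map_K (p q : nat -> R) (f : nat -> C) : arc -> C := fun a =>
  match a with
  | ArcR j => (Num.sqrt (p j))%:C * f j
  | ArcL j => (Num.sqrt (q j))%:C * f j
  end.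

(* m_V is only defined up to a nonzero scalar. *)
Definition is_mV (p q : nat -> R) (m : nat -> C) : Prop :=
  m 0%N != 0 /\
  forall j, m j / m 0%N =
    (Num.sqrt ((\prod_(0 <= i < j) p i) / (\prod_(1 <= i < j.+1) q i)))%:C.

Definition psi_star (p q : nat -> R) : arc -> C :=
  let v j : C :=
    (Num.sqrt ((\prod_(0 <= i < j.+1) p i) / (\prod_(0 <= i < j.+1) q i)))%:C in
  fun a =>
  match a with
  | ArcL 0 => 1
  | ArcL j.+1 => v j
  | ArcR j => v j
  end.

End QuantumWalk.

(* Main.v *)
(* Fix a state s and let g(y) be the expected number of visits to y before the
   first return to s. Counting the start, g(s) >= 1; the sum of g is the mean
   return time, hence finite; and g is P-superharmonic (as a measure) off s.
   - With s = j+1, the flow from i to i+1 balances from 0 upwards: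
     q_(i+1) g(i+1) <= p_i g(i) for i <= j, and g(j+1) >= 1 forces p_j > 0.
   - With s = 0, the net flow p_j g(j) - q_(j+1) g(j+1) is nondecreasing in j
     and bounded by the summable g(j), hence it is <= 0. Thus g dominates the
     reversible measure m_V^2, which is therefore summable.
   Since z + eta_j, z - conj(eta_j) and rho_j are 2 sin(phi) times q_j, p_j and
   sqrt(p_j q_j), the equation U psi = z psi reduces, as all p_j > 0, to
   psi(j+1;L) = psi(j;R) and sqrt(p_j) psi(j;L) = sqrt(q_j) psi(j;R), whose
   solutions are determined by psi(0;R). *)
Require Import Defs.
From mathcomp Require Import all_boot all_order all_algebra.
From mathcomp Require Import all_classical all_reals all_analysis.
From mathcomp Require Import complex measurable_realfun.
From mathcomp Require Import zify ring lra.

Import Order.TTheory GRing.Theory Num.Theory numFieldNormedType.Exports.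
Local Open Scope classical_set_scope.
Local Open Scope ring_scope.
Local Open Scope complex_scope.

(** * Mean return times *)

(** The supremum defining the integral of [f] runs over simple functions that also lie below [g]. In
    this form the bound applies to [return_time], whose measurability is never proved. *)
Lemma le_integral_of_le d (T : measurableType d) (R : realType)
    (mu : {measure set T -> \bar R}) (f g : T -> \bar R) :
  (forall x, (0 <= f x)%E) -> (forall x, (f x <= g x)%E) ->
  (\int[mu]_x f x <= \int[mu]_x g x)%E.
Proof.
move=> f0 fg; rewrite !ge0_integralTE//; last first.
  by move=> x; exact: le_trans (f0 x) (fg x).
apply: le_ereal_sup => _ [h hf <-]; exists h => // x.
exact: le_trans (hf x) (fg x).
Qed.

Section MarkovChain.
Context {R : realType} {d : measure_display} {T : measurableType d}.
Variables (Pr : probability T R) (X : nat -> T -> nat).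
Variables (trans : nat -> nat -> R) (s : nat).
Hypothesis Xmarkov : is_markov_chain trans s Pr X.

(* For m = 0 these are the cylinders of the Markov property; one more coordinate
   is freed at a time by summing over its countably many values. *)
Definition relaxed_past (A : nat -> set nat) (m n : nat) (x : nat -> nat) : set T :=
  [set w | forall i, (i <= n)%N -> if (i < m)%N then A i (X i w) else X i w = x i].

Lemma measurable_state (n : nat) (B : set nat) : measurable [set w | B (X n w)].
Proof.
case: Xmarkov => mX _ _.
have -> : [set w | B (X n w)] = [set: T] `&` X n @^-1` B by rewrite setTI.
exact: mX.
Qed.

Lemma measurable_past (n : nat) (B : nat -> set nat) :
  measurable [set w | forall i, (i <= n)%N -> B i (X i w)].
Proof.
have -> : [set w | forall i, (i <= n)%N -> B i (X i w)] =
    \bigcap_(i in [set k | (k <= n)%N]) [set w | B i (X i w)] by [].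
by apply: bigcap_measurableType => // i _; exact: measurable_state.
Qed.

Lemma measurable_relaxed A m n x : measurable (relaxed_past A m n x).
Proof.
rewrite /relaxed_past; have := measurable_past n
  (fun i v => if (i < m)%N then A i v else v = x i).
by congr measurable; apply/seteqP; split => w /= H i /H; case: ifP.
Qed.

Lemma markov_relaxed A m n x y : (m <= n)%N ->
  Pr (relaxed_past A m n x `&` [set w | X n.+1 w = y]) =
  (Pr (relaxed_past A m n x) * (trans (x n) y)%:E)%E.
Proof.
elim: m x => [|m IHm] x mn.
  by case: Xmarkov => _ _ /(_ n x y).
(* [upd k] pins coordinate m at k; since m < n the present state [x n] is kept, so every term
   carries the same transition factor. *)
pose upd (k i : nat) : nat := if i == m then k else x i.
have decomp : relaxed_past A m.+1 n x =
    \bigcup_(k in A m) relaxed_past A m n (upd k).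
  apply/seteqP; split => w /=.
    move=> H; exists (X m w).
      by have := H m (ltnW mn); rewrite ltnSn.
    move=> i /[dup] ile /H; rewrite ltnS /upd.
    by case: ltngtP => // ->.
  move=> [k Ak H] i ile; have := H i ile; rewrite ltnS /upd.
  by case: ltngtP => // -> ->.
have triv (F : set T) :
    trivIset (A m) (fun k => relaxed_past A m n (upd k) `&` F).
  move=> i j _ _ [w [[/(_ m (ltnW mn)) + _] [/(_ m (ltnW mn)) + _]]].
  by rewrite ltnn /upd eqxx => -> ->.
rewrite decomp setI_bigcupl measure_bigcup; first last.
- exact: triv.
- move=> k _; apply: measurableI; first exact: measurable_relaxed.
  exact: (measurable_state n.+1 [set y]).
have := triv setT; under eq_fun do rewrite setIT.
move=> triv'; rewrite [in RHS]measure_bigcup//; last first.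
  by move=> k _; exact: measurable_relaxed.
rewrite muleC -[RHS]nneseriesZl//.
apply: eq_eseriesr => k _.
by apply: etrans (IHm _ (ltnW mn)) _; rewrite muleC /upd (gtn_eqF mn).
Qed.

(** Time 0 is exempt from the taboo on s, because the chain starts there. *)
Definition taboo_event (n j : nat) : set T :=
  [set w | (forall i, (0 < i <= n)%N -> X i w <> s) /\ X n w = j].

Definition taboo_prob (n j : nat) : R := fine (Pr (taboo_event n j)).

Definition no_return (n : nat) : set T :=
  [set w | forall i, (0 < i <= n)%N -> X i w <> s].

Lemma measurable_no_return n : measurable (no_return n).
Proof.
have := measurable_past n (fun i v => (0 < i)%N -> v <> s).
by congr measurable; apply/seteqP; split => w /= H i;
  [case/andP=> ? ?; exact: H | move=> ? ?; apply: H; apply/andP].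
Qed.

Lemma taboo_eventE n j :
  taboo_event n j = no_return n `&` [set w | X n w = j].
Proof. by []. Qed.

Lemma measurable_taboo n j : measurable (taboo_event n j).
Proof.
rewrite taboo_eventE; apply: measurableI; first exact: measurable_no_return.
exact: (measurable_state n [set j]).
Qed.

Lemma taboo_probE n j : (taboo_prob n j)%:E = Pr (taboo_event n j).
Proof. by rewrite fineK// fin_num_measure//; exact: measurable_taboo. Qed.

Lemma taboo_prob_ge0 n j : 0 <= taboo_prob n j.
Proof. exact/fine_ge0. Qed.

Lemma taboo_prob0 : taboo_prob 0 s = 1.
Proof.
rewrite /taboo_prob; have -> : taboo_event 0 s = [set w | X 0%N w = s].
  by apply/seteqP; split => w /=; [case | split=> // i; case: i].
by case: Xmarkov => _ ->.
Qed.

Lemma markov_taboo n j y : (n == 0%N) || (j != s) ->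
  Pr (taboo_event n j `&` [set w | X n.+1 w = y]) =
  (taboo_prob n j * trans j y)%:E.
Proof.
move=> nj; rewrite EFinM taboo_probE.
(* Coordinates before n avoid s from time 1 on, and coordinate n is pinned at j; for n > 0 the side
   condition keeps j off s. *)
have -> : taboo_event n j = relaxed_past (fun i v => (0 < i)%N -> v <> s) n n (fun=> j).
  apply/seteqP; split => w /=.
    move=> [H Xj] i ile; case: ltnP => [i_n i0|ni].
      by apply: H; rewrite i0.
    by rewrite -Xj; congr (X _ w); apply/eqP; rewrite eqn_leq ile.
  move=> H; have Xj : X n w = j by have := H n (leqnn n); rewrite ltnn.
  split=> // i /andP[i0 ile]; have := H i ile; case: ltnP => [_ Hi|ni ->]; first exact: Hi.
  case/orP: nj => [/eqP n0|/eqP//].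
  by move: i0; rewrite n0 in ile; move: ile; rewrite leqn0 => /eqP ->.
exact: markov_relaxed.
Qed.

Lemma taboo_event_s n : taboo_event n.+1 s = set0.
Proof. by apply/seteqP; split => w //= [H]; apply: H; rewrite leqnn. Qed.

(** For distinct j, being at j at time n and then at y are disjoint subevents of
    [taboo_event n.+1 y], since y respects the taboo. Only j < J are counted, hence an
    inequality. *)
Lemma taboo_prob_super n J y : y != s ->
  \sum_(j < J) taboo_prob n j * trans j y <= taboo_prob n.+1 y.
Proof.
move=> ys; rewrite -lee_fin taboo_probE -sumEFin.
pose F j := taboo_event n j `&` [set w | X n.+1 w = y].
have mF j : measurable (F j).
  apply: measurableI; first exact: measurable_taboo.
  exact: (measurable_state n.+1 [set y]).
have -> : (\sum_(j < J) (taboo_prob n j * trans j y)%:E)%R =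
          (\sum_(j < J) Pr (F j))%R.
  apply: eq_bigr => j _; have [nj|] := boolP ((n == 0%N) || (j != s :> nat)).
    by rewrite markov_taboo.
  rewrite negb_or negbK => /andP[n0 /eqP jE].
  case: n n0 @F mF => // n _ F mF.
  by rewrite /F jE /taboo_prob taboo_event_s set0I measure0 mul0r.
rewrite -measure_bigsetU//; last first.
  by move=> i j _ _ [w [[[_ <-] _] [[_ <-] _]]].
apply: le_measure; rewrite ?inE.
- exact: bigsetU_measurable.
- exact: measurable_taboo.
rewrite -(bigcup_mkord J F) => w [j _ [[H _] Xy]]; split=> // i /andP[i0].
rewrite leq_eqVlt => /orP[/eqP ->|ilt]; first by rewrite Xy; apply/eqP.
by apply: H; rewrite i0.
Qed.

Lemma sum_taboo_prob_le n J :
  ((\sum_(j < J) taboo_prob n j)%:E <= Pr (no_return n))%E.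
Proof.
rewrite -sumEFin; under eq_bigr do rewrite taboo_probE.
rewrite -measure_bigsetU//.
- apply: le_measure; rewrite ?inE.
  + by apply: bigsetU_measurable => j _; exact: measurable_taboo.
  + exact: measurable_no_return.
  by rewrite -(bigcup_mkord J) => w [j _ []].
- exact: measurable_taboo.
- by move=> i j _ _ [w [[_ <-] [_ <-]]].
Qed.

(** Half of the tail-sum formula E[tau] = sum of Pr(tau > n): pointwise, at most tau of the events
    [no_return n] occur. *)
Lemma sum_no_return_le_integral N :
  (\sum_(n < N) Pr (no_return n) <= \int[Pr]_w return_time R X s w)%E.
Proof.
have -> : (\sum_(n < N) Pr (no_return n))%E =
    (\int[Pr]_w \sum_(n < N) (\1_(no_return n) w)%:E)%E.
  rewrite ge0_integral_sum//.
  - apply: eq_bigr => n _; rewrite integral_indic// ?setIT//.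
    exact: measurable_no_return.
  - move=> n; apply/measurable_EFinP; apply/measurable_indicP.
    exact: measurable_no_return.
apply: le_integral_of_le => w.
  by apply: sume_ge0 => n _; rewrite lee_fin.
(* A visit to s at time t > 0 excludes [no_return n] for n >= t; with no such t the infimum is
   +oo. *)
apply: le_ereal_inf_tmp => _ [t [t0 Xt] <-].
rewrite sumEFin lee_fin.
have minE M : (\sum_(n < M) (n < t) = minn M t)%N.
  elim: M => [|M IHM]; first by rewrite big_ord0 min0n.
  by rewrite big_ord_recr/= IHM; lia.
apply: (@le_trans _ _ (\sum_(n < N) (n < t)%N)%:R); last first.
  by rewrite ler_nat minE geq_minr.
rewrite natr_sum; apply: ler_sum => n _; rewrite indicE ler_nat.
case: ltnP => [_|tn]; first by case: (_ \in _).
by rewrite memNset//= => /(_ t); rewrite t0 => /(_ tn).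
Qed.

(** The witness g is the increasing limit of truncated visit counts and M is the mean return time;
    as the sums range over finitely many states, the bounds pass to the limit. *)
Lemma finite_mean_return_superharmonic :
  (\int[Pr]_w return_time R X s w < +oo)%E ->
  exists (g : nat -> R) (M : R),
    [/\ forall j, 0 <= g j, 1 <= g s,
        forall J, \sum_(j < J) g j <= M
      & forall J y, y != s -> \sum_(j < J) g j * trans j y <= g y].
Proof.
move=> ET; (* G N j: expected visits to j before time N and before returning to s. *)
pose G N j := \sum_(n < N) taboo_prob n j.
have ET0 : (0 <= \int[Pr]_w return_time R X s w)%E.
  apply: integral_ge0 => w _; apply: le_ereal_inf_tmp => _ [t _ <-].
  by rewrite lee_fin.
pose M := fine (\int[Pr]_w return_time R X s w)%E.
have GM N J : \sum_(j < J) G N j <= M.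
  rewrite -lee_fin /M fineK ?ge0_fin_numE// exchange_big/= -sumEFin.
  apply: le_trans (sum_no_return_le_integral N).
  by apply: lee_sum => n _; exact: sum_taboo_prob_le.
have Gnd j : {homo G ^~ j : n m / (n <= m)%N >-> n <= m}.
  apply/nondecreasing_seqP => n; rewrite /G big_ord_recr/= lerDl.
  exact: taboo_prob_ge0.
have G0 N j : 0 <= G N j by apply: sumr_ge0 => *; exact: taboo_prob_ge0.
have Gcvg j : cvgn (G ^~ j).
  apply: nondecreasing_is_cvgn => //; exists M => _ [N _ <-].
  apply: le_trans (GM N j.+1); rewrite big_ord_recr/= lerDr.
  exact: sumr_ge0.
pose g j : R := limn (G ^~ j).
have cvg_sumG J (c : nat -> R) : (fun N => \sum_(j < J) G N j * c j) @ \oo -->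
    \sum_(j < J) g j * c j.
  elim: J => [|J IHJ].
    under eq_fun do rewrite big_ord0.
    by rewrite big_ord0; exact: cvg_cst.
  under eq_fun do rewrite big_ord_recr/=.
  rewrite big_ord_recr/=; apply: cvgD => //; apply: cvgMl; exact: Gcvg.
have leg N j : G N j <= g j := nondecreasing_cvgn_le (Gnd j) (Gcvg j) N.
have lim_le (u : nat -> R) (l c : R) :
    u n @[n --> \oo] --> l -> (forall n, u n <= c) -> l <= c.
  move=> ul uc; rewrite -(cvg_lim _ ul)//; apply: limr_le; first by apply: cvgP ul.
  exact: nearW.
exists g, M; split.
- by move=> j; exact: le_trans (leg 0%N j).
- by apply: le_trans (leg 1%N s); rewrite /G big_ord1 taboo_prob0.
- move=> J; have := @cvg_sumG J (fun=> 1).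
  under eq_bigr do rewrite mulr1.
  move=> /lim_le; apply => N; under eq_bigr do rewrite mulr1.
  exact: GM.
- move=> J y ys; apply: (lim_le _ _ _ (@cvg_sumG J (trans ^~ y))) => N.
  apply: le_trans (leg N.+1 y).
  (* Time shift: without its term n = 0, [G N.+1 y] sums taboo probabilities at times n + 1, each
     bounding one step from time n. *)
  rewrite /G big_ord_recl -[leLHS]add0r lerD ?taboo_prob_ge0//.
  under eq_bigr do rewrite mulr_suml.
  rewrite exchange_big/=; apply: ler_sum => n _.
  exact: taboo_prob_super.
Qed.
End MarkovChain.

(** * Birth-and-death chains *)

Section HalfLine.
Context {R : realType}.
Variables p q : nat -> R.
Hypothesis p_ge0 : forall j, 0 <= p j.
Hypothesis q_ge0 : forall j, 0 <= q j.
Hypothesis pq1 : forall j, p j + q j = 1.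
Hypothesis q_gt0 : forall j, 0 < q j.+1.

Lemma half_line_trans_ge0 j k : 0 <= half_line_trans p q j k.
Proof. by rewrite /half_line_trans; case: ifP => // _; case: ifP. Qed.

Lemma positive_recurrent_superharmonic s :
  positive_recurrent_at (half_line_trans p q) s ->
  exists (g : nat -> R) (M : R),
    [/\ forall j, 0 <= g j, 1 <= g s,
        forall J, \sum_(j < J) g j <= M,
        0%N != s -> g 1%N * q 1%N <= g 0%N * p 0%N
      & forall y, y.+1 != s -> g y * p y + g y.+2 * q y.+2 <= g y.+1].
Proof.
move=> [d [T [Pr [X [mX _ ET]]]]].
have [g [M [g0 gs gM gsup]]] := finite_mean_return_superharmonic _ _ _ _ mX ET.
have gt0 J y : 0 <= \sum_(j < J) g j * half_line_trans p q j y.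
  by apply: sumr_ge0 => j _; rewrite mulr_ge0// half_line_trans_ge0.
exists g, M; split => //.
(* J = 2 covers 0 and 1, the only states leading to 0; the self-loop term g_0 q_0 is absorbed
   through q_0 = 1 - p_0. *)
- move=> s0; have := gsup 2%N _ s0.
  rewrite !big_ord_recr big_ord0/= /half_line_trans/=.
  by have := pq1 0%N; nra.
(* J = y + 3 covers both neighbours of y + 1; the remaining terms are nonnegative. *)
- move=> y ys; have := gsup y.+3 _ ys; have := gt0 y y.+1.
  have := mulr_ge0 (g0 y.+1) (half_line_trans_ge0 y.+1 y.+1).
  have up : half_line_trans p q y y.+1 = p y by rewrite /half_line_trans eqxx.
  have down : half_line_trans p q y.+2 y.+1 = q y.+2.
    by rewrite /half_line_trans/= eqxx ifF//; apply/eqP; lia.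
  by rewrite !big_ord_recr/= up down; lra.
Qed.

(** If p_j were 0, a chain started at j + 1 would step down with probability q_(j+1) > 0 and never
    return. *)
Lemma positive_recurrent_p_gt0 :
  positive_recurrent (half_line_trans p q) -> forall j, 0 < p j.
Proof.
move=> pr j.
have [g [M [g0 gs _ gsup0 gsup]]] := positive_recurrent_superharmonic _ (pr j.+1).
have flux i : (i <= j)%N -> g i.+1 * q i.+1 <= g i * p i.
  elim: i => [_|i IHi ij]; first exact: gsup0.
  have := gsup i; rewrite eqSS (ltn_eqF ij) => /(_ isT).
  by have := IHi (ltnW ij); have := pq1 i.+1; nra.
rewrite lt_neqAle p_ge0 andbT; apply/eqP => pj0.
by have := flux j (leqnn j); rewrite -pj0 mulr0 leNgt mulr_gt0// (lt_le_trans _ gs).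
Qed.

(** This is (m_V(j) / m_V(0))^2, the solution of detailed balance pi_j p_j = pi_(j+1) q_(j+1) with
    pi_0 = 1. *)
Definition reversible_measure (j : nat) : R :=
  (\prod_(0 <= i < j) p i) / (\prod_(1 <= i < j.+1) q i).

Lemma reversible_measure0 : reversible_measure 0 = 1.
Proof. by rewrite /reversible_measure !big_geq// divr1. Qed.

Lemma reversible_measureS j :
  reversible_measure j.+1 = reversible_measure j * p j / q j.+1.
Proof.
by rewrite /reversible_measure (big_nat_recr j) ?(big_nat_recr j.+1)//= invfM mulrACA mulrA.
Qed.

Lemma reversible_measure_ge0 j : 0 <= reversible_measure j.
Proof. by rewrite /reversible_measure divr_ge0// prodr_ge0. Qed.

Lemma reversible_measure_summable :
  positive_recurrent_at (half_line_trans p q) 0 ->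
  exists M, forall J, \sum_(j < J) reversible_measure j <= M.
Proof.
move=> pr.
have [g [M [g0 gs gM _ gsup]]] := positive_recurrent_superharmonic _ pr.
(* The net flow through the edge {j, j+1}. *)
pose D j := g j * p j - g j.+1 * q j.+1.
(* D_(j+1) - D_j = g_(j+1) - g_j p_j - g_(j+2) q_(j+2), which superharmonicity makes nonnegative. *)
have Dnd k n : D k <= D (k + n)%N.
  elim: n => [|n IHn]; first by rewrite addn0.
  apply: le_trans IHn _; rewrite addnS /D.
  by have := gsup (k + n)%N isT; have := pq1 (k + n).+1; nra.
(* A positive D_k would bound every g_j with j >= k from below, and n such terms exceed M for large
   n. *)
have Dle0 k : D k <= 0.
  rewrite leNgt; apply/negP => Dk.
  have gD n : D k <= g (k + n)%N.
    apply: le_trans (Dnd k n) _; rewrite /D.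
    have := pq1 (k + n)%N; have := q_ge0 (k + n)%N.
    have := mulr_ge0 (g0 (k + n).+1) (q_ge0 (k + n).+1).
    have := g0 (k + n)%N; nra.
  have nD n : n%:R * D k <= M.
    apply: le_trans (gM (k + n)%N); rewrite big_split_ord/=.
    rewrite -[leLHS]add0r lerD ?sumr_ge0// mulr_natl -[in leLHS](card_ord n).
    by rewrite -sumr_const; apply: ler_sum => i _; exact: gD.
  have M0 : 0 <= M by apply: le_trans (gM 0%N); rewrite big_ord0.
  have := archi_boundP (divr_ge0 M0 (ltW Dk)).
  by rewrite ltr_pdivrMr// ltNge nD.
exists M => J; apply: le_trans (gM J); apply: ler_sum => j _.
(* Inductively pi_(j+1) q_(j+1) = pi_j p_j <= g_j p_j <= g_(j+1) q_(j+1), the last step because D_j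
   <= 0. *)
elim: (nat_of_ord j) => {j} [|j IHj]; first by rewrite reversible_measure0.
rewrite reversible_measureS ler_pdivrMr//.
apply: le_trans (_ : g j * p j <= _); first by rewrite ler_wpM2r.
by have := Dle0 j; rewrite /D subr_le0.
Qed.
End HalfLine.

(** * The eigenvalue equation *)

Section Balanced.
Context {R : realType}.
Local Notation C := R[i].
Variables p q : nat -> R.
Hypothesis p_gt0 : forall j, 0 < p j.
Hypothesis q_gt0 : forall j, 0 < q j.+1.

Let sp j : C := (Num.sqrt (p j))%:C.
Let sq j : C := (Num.sqrt (q j))%:C.

(* The coinwise eigenvector condition together with S-invariance. *)
Definition balanced (psi : Defs.arc -> C) : Prop :=
  forall j, psi (ArcL j.+1) = psi (ArcR j) /\
            sp j * psi (ArcL j) = sq j * psi (ArcR j).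

Let sp_neq0 j : sp j != 0.
Proof. by rewrite (inj_eq (@complexI R) _ 0) sqrtr_eq0 -ltNge. Qed.

Let sq_neq0 j : sq j.+1 != 0.
Proof. by rewrite (inj_eq (@complexI R) _ 0) sqrtr_eq0 -ltNge. Qed.

Lemma balanced_scale c psi : balanced psi -> balanced (fun a => c * psi a).
Proof.
by move=> bpsi j; have [-> e] := bpsi j; rewrite mulrCA e mulrCA.
Qed.

(** The value at (j;R) passes to (j+1;L), then to (j+1;R) on dividing by sqrt(q_(j+1)); the value at
    (j;L) follows on dividing by sqrt(p_j). *)
Lemma balanced_inj psi phi : balanced psi -> balanced phi ->
  psi (ArcR 0) = phi (ArcR 0) -> psi = phi.
Proof.
move=> bpsi bphi e0.
have eR j : psi (ArcR j) = phi (ArcR j).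
  elim: j => // j IHj; apply: (mulfI (sq_neq0 j)).
  by rewrite -(bpsi j.+1).2 -(bphi j.+1).2 (bpsi j).1 (bphi j).1 IHj.
apply/funext => -[j|j] //; apply: (mulfI (sp_neq0 j)).
by rewrite (bpsi j).2 (bphi j).2 eR.
Qed.

Lemma balanced_line phi : balanced phi -> phi (ArcR 0) != 0 ->
  [set psi | balanced psi] = line phi.
Proof.
move=> bphi phi0; apply/seteqP; split => psi /=; last first.
  by move=> [c _ <-]; exact: balanced_scale.
move=> bpsi; exists (psi (ArcR 0) / phi (ArcR 0)) => //.
apply: balanced_inj => //; first exact: balanced_scale.
by rewrite divfK.
Qed.

(** The square root of detailed balance, which makes Km_V invariant under the shift. *)
Lemma sqrt_reversible_measureS j :
  Num.sqrt (q j.+1) * Num.sqrt (reversible_measure p q j.+1) =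
  Num.sqrt (p j) * Num.sqrt (reversible_measure p q j).
Proof.
rewrite -!sqrtrM ?ltW// reversible_measureS; congr Num.sqrt.
by rewrite mulrC divfK ?gt_eqF// mulrC.
Qed.

Lemma is_mVE m : is_mV p q m ->
  forall j, m j = m 0%N * (Num.sqrt (reversible_measure p q j))%:C.
Proof. by move=> [m0 mE] j; rewrite -mE mulrC divfK. Qed.

Lemma balanced_map_K m : is_mV p q m -> balanced (map_K p q m).
Proof.
move=> /is_mVE mE j; split; last by rewrite /= mulrCA.
rewrite /= (mE j.+1) (mE j) mulrCA [RHS]mulrCA -!rmorphM/=.
by rewrite sqrt_reversible_measureS.
Qed.

Lemma map_K_neq0 m : is_mV p q m -> map_K p q m (ArcR 0) != 0.
Proof. by move=> [m0 _]; exact: mulf_neq0 (sp_neq0 0) m0. Qed.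

(** The condition q_0 <> 0 enters at the self loop, where sqrt(p_0) = sqrt(q_0) sqrt(p_0/q_0) is
    required. *)
Lemma balanced_psi_star : q 0%N != 0 -> (forall j, 0 <= q j) ->
  balanced (psi_star p q).
Proof.
move=> q0 q_ge0.
have q_neq0 j : q j != 0 by case: j => // j; rewrite gt_eqF.
move=> j; split => //; rewrite /sp /sq.
case: j => [|j]; rewrite /psi_star -!rmorphM/= ?mulr1; congr (_ %:C).
  rewrite -sqrtrM// !big_nat1; congr Num.sqrt.
  by rewrite mulrC divfK.
rewrite -!sqrtrM//; last exact: ltW.
congr Num.sqrt; rewrite (big_nat_recr j.+1)//= (big_nat_recr j.+1 0 q)//=.
by rewrite invfM mulrACA [RHS]mulrCA (mulrCA (q _)) divff// mulr1 mulrC.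
Qed.

End Balanced.

(** * Square summability *)

Section SquareSummable.
Context {R : realType}.
Local Notation C := R[i].

Lemma modulusM (x y : C) : modulus (x * y) = modulus x * modulus y.
Proof.
rewrite /modulus -sqrtrM ?addr_ge0 ?sqr_ge0//; congr Num.sqrt.
by case: x => a b; case: y => a' b' /=; ring.
Qed.

Lemma modulus_real (x : R) : 0 <= x -> modulus x%:C = x.
Proof. by move=> x0; rewrite /modulus/= expr0n addr0 sqrtr_sqr ger0_norm. Qed.

Lemma l2_nat_bounded (f : nat -> C) (M : R) :
  (forall J, \sum_(j < J) modulus (f j) ^+ 2 <= M) -> l2 f.
Proof.
move=> fM; rewrite /l2/= -nneseries_esumT => [|n]; last by rewrite lee_fin sqr_ge0.
apply: (@le_lt_trans _ _ M%:E); last exact: ltry.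
apply: lime_le.
  by apply: is_cvg_nneseries => n _ _; rewrite lee_fin sqr_ge0.
apply: nearW => J; rewrite sumEFin lee_fin big_mkord.
exact: fM.
Qed.

(** The arcs split by label into two copies of the vertices, and on each copy K multiplies by a
    factor at most 1. *)
Lemma l2_map_K (p q : nat -> R) (f : nat -> C) :
  (forall j, 0 <= p j <= 1) -> (forall j, 0 <= q j <= 1) ->
  l2 f -> l2 (map_K p q f).
Proof.
move=> p01 q01; rewrite /l2/= => l2f.
have scaled (c : nat -> R) : (forall j, 0 <= c j <= 1) ->
    (\esum_(j in [set: nat]) (modulus ((Num.sqrt (c j))%:C * f j) ^+ 2)%:E < +oo)%E.
  move=> c01; apply: le_lt_trans l2f; apply: le_esum => j _.
  have /andP[c0 c1] := c01 j.
  rewrite lee_fin modulusM modulus_real ?sqrtr_ge0// exprMn sqr_sqrtr//.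
  by rewrite ler_piMl ?sqr_ge0.
rewrite (esumID (range ArcR)) => [|a _]; last by rewrite lee_fin sqr_ge0.
have -> : [set: Defs.arc] `&` ~` range ArcR = range ArcL.
  apply/seteqP; split => -[j|j] /=.
  - by move=> [_ []]; exists j.
  - by exists j.
  - by move=> [].
  - by split=> // -[].
rewrite setTI !esum_image; first last.
- by move=> i j _ _ [].
- by move=> i j _ _ [].
by rewrite lte_add_pinfty//; exact: scaled.
Qed.

Lemma l2_mV (p q : nat -> R) (c : C) (f : nat -> C) (M : R) :
  (forall j, 0 <= reversible_measure p q j) ->
  (forall J, \sum_(j < J) reversible_measure p q j <= M) ->
  (forall j, f j = c * (Num.sqrt (reversible_measure p q j))%:C) ->
  l2 f.
Proof.
move=> pi0 piM fE; apply: (@l2_nat_bounded _ (modulus c ^+ 2 * M)) => J.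
have sqE j : modulus (f j) ^+ 2 = modulus c ^+ 2 * reversible_measure p q j.
  rewrite fE modulusM (modulus_real _ (sqrtr_ge0 _)) exprMn.
  by rewrite [X in _ * X]sqr_sqrtr.
by under eq_bigr do rewrite sqE; rewrite -mulr_sumr ler_wpM2l ?sqr_ge0.
Qed.

End SquareSummable.

(** * Coin parameters and reduction of the eigenvalue equation *)

Section Eigenvalue.
Context {R : realType}.
Local Notation C := R[i].
Variables (kappa : R) (eta : nat -> C).
Hypothesis eta_le1 : forall j, modulus (eta j) <= 1.
Hypothesis eta_Im : forall j, complex.Im (eta j) = kappa.
Hypothesis kappa_neq1 : kappa != 1.
Hypothesis kappa_neqN1 : kappa != - 1.

Let p := prob_p kappa eta.
Let q := prob_q kappa eta.
Let sphi := Num.sqrt (1 - kappa ^+ 2).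

Lemma modulus_sqr (x : C) :
  modulus x ^+ 2 = complex.Re x ^+ 2 + complex.Im x ^+ 2.
Proof. by rewrite /modulus sqr_sqrtr// addr_ge0 ?sqr_ge0. Qed.

Lemma Re_Im_eta_le1 j : complex.Re (eta j) ^+ 2 + kappa ^+ 2 <= 1.
Proof.
by rewrite -(eta_Im j) -modulus_sqr expr_le1 ?sqrtr_ge0// eta_le1.
Qed.

Lemma kappa_lt1 : -1 < kappa < 1.
Proof.
have := Re_Im_eta_le1 0; have := sqr_ge0 (complex.Re (eta 0%N)) => r0 k1.
rewrite lt_neqAle [kappa < 1]lt_neqAle eq_sym kappa_neqN1 kappa_neq1/=.
by apply/andP; split; nra.
Qed.

Lemma sphi_sqr : sphi ^+ 2 = 1 - kappa ^+ 2.
Proof. by rewrite sqr_sqrtr//; have /andP[] := kappa_lt1; nra. Qed.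

Lemma sphi_gt0 : 0 < sphi.
Proof. by rewrite sqrtr_gt0; have /andP[] := kappa_lt1; nra. Qed.

Lemma prob_pE j : 2 * sphi * p j = sphi - complex.Re (eta j).
Proof. by rewrite /p /prob_p -/sphi; field; rewrite gt_eqF ?sphi_gt0. Qed.

Lemma prob_qE j : 2 * sphi * q j = sphi + complex.Re (eta j).
Proof. by rewrite /q /prob_q -/sphi; field; rewrite gt_eqF ?sphi_gt0. Qed.

Lemma prob_pq1 j : p j + q j = 1.
Proof. by rewrite /p /q /prob_p /prob_q; lra. Qed.

Lemma abs_Re_eta_le j : - sphi <= complex.Re (eta j) <= sphi.
Proof.
have := sphi_gt0; have := sphi_sqr; have := Re_Im_eta_le1 j.
by move=> r1 s2 s0; apply/andP; split; nra.
Qed.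

Lemma prob_p_ge0 j : 0 <= p j.
Proof.
have := prob_pE j; have := abs_Re_eta_le j; have := sphi_gt0.
by move=> s0 /andP[_ rs] e; rewrite -(pmulr_rge0 _ (_ : 0 < 2 * sphi)) ?mulr_gt0// e subr_ge0.
Qed.

Lemma prob_q_ge0 j : 0 <= q j.
Proof.
have := prob_qE j; have := abs_Re_eta_le j; have := sphi_gt0.
by move=> s0 /andP[rs _] e; rewrite -(pmulr_rge0 _ (_ : 0 < 2 * sphi)) ?mulr_gt0// e; lra.
Qed.

(** Here rho_j^2 = sin(phi)^2 - Re(eta_j)^2 factors as (2 sin(phi) p_j)(2 sin(phi) q_j). *)
Lemma rhoE j : rho eta j = 2 * sphi * (Num.sqrt (p j) * Num.sqrt (q j)).
Proof.
have s20 : 0 <= 2 * sphi by rewrite mulr_ge0// ltW ?sphi_gt0.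
rewrite -sqrtrM ?prob_p_ge0// -[X in X * _](ger0_norm s20) -sqrtr_sqr.
rewrite -sqrtrM ?sqr_ge0// /rho modulus_sqr eta_Im; congr Num.sqrt.
have -> : (2 * sphi) ^+ 2 * (p j * q j) = (2 * sphi * p j) * (2 * sphi * q j) by ring.
rewrite prob_pE prob_qE; have s2 := sphi_sqr.
by ring: s2.
Qed.

Let z : C := sphi -i* kappa.

Lemma eigenvalueE : - (0 +i* 1) * expi (acos kappa) = z.
Proof.
have /andP[/ltW k0 /ltW k1] := kappa_lt1.
rewrite /expi sin_acos ?k0// acosK ?in_itv/= ?k0//.
by apply/eqP; rewrite eq_complex /= oppr0 !mul0r !mulN1r !add0r opprK !eqxx.
Qed.

(** The imaginary parts cancel because Im(eta_j) = kappa, leaving sin(phi) + Re(eta_j). *)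
Lemma eta_add_eigenvalue j :
  z + eta j = (2 * sphi)%:C * (Num.sqrt (q j))%:C ^+ 2.
Proof.
rewrite -rmorphXn -rmorphM/= sqr_sqrtr ?prob_q_ge0// prob_qE.
apply/eqP; rewrite eq_complex /=; move: (eta_Im j); case: (eta j) => a b /= ->.
by apply/andP; split; apply/eqP; ring.
Qed.

Lemma eigenvalue_sub_conj_eta j :
  z - (eta j)^* = (2 * sphi)%:C * (Num.sqrt (p j))%:C ^+ 2.
Proof.
rewrite -rmorphXn -rmorphM/= sqr_sqrtr ?prob_p_ge0// prob_pE.
apply/eqP; rewrite eq_complex /=; move: (eta_Im j); case: (eta j) => a b /= ->.
by apply/andP; split; apply/eqP; ring.
Qed.

Lemma rhoEC j : (rho eta j)%:C =
  (2 * sphi)%:C * (Num.sqrt (p j))%:C * (Num.sqrt (q j))%:C.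
Proof. by rewrite rhoE -!rmorphM/= mulrA. Qed.

Lemma eigenvalue_neq0 : z != 0.
Proof. by rewrite eq_complex/= negb_and (gt_eqF sphi_gt0). Qed.

(** The forward direction climbs from the self loop, where the equation involves vertex 0 alone. The
    coin condition at j and the equation at (j+1;L) give psi(j+1;L) = psi(j;R); the equation at
    (j;R) then becomes the coin condition at j + 1. *)
Lemma eigenfunction_balanced (psi : Defs.arc -> C) : (forall j, 0 < p j) ->
  (forall a, z * psi a - walk eta psi a = 0) <-> balanced p q psi.
Proof.
move=> p_gt0.
have K0 : (2 * sphi)%:C != 0.
  by rewrite (inj_eq (@complexI R) _ 0) gt_eqF// mulr_gt0// sphi_gt0.
have sp0 j : (Num.sqrt (p j))%:C != 0.
  by rewrite (inj_eq (@complexI R) _ 0) sqrtr_eq0 -ltNge.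
have conjE j : (eta j)^* = z - (2 * sphi)%:C * (Num.sqrt (p j))%:C ^+ 2.
  by rewrite -eigenvalue_sub_conj_eta; ring.
have etaE j : eta j = (2 * sphi)%:C * (Num.sqrt (q j))%:C ^+ 2 - z.
  by rewrite -eta_add_eigenvalue; ring.
(* [w j] is the coin output at (j;L), which the shift sends to (j-1;R), or back to the self loop if
   j = 0. *)
pose w j := (2 * sphi)%:C * (Num.sqrt (p j))%:C * (Num.sqrt (q j))%:C * psi (ArcR j) +
    (z - (2 * sphi)%:C * (Num.sqrt (p j))%:C ^+ 2) * psi (ArcL j).
have walkR j : walk eta psi (ArcR j) = w j.+1 by rewrite /w -conjE -rhoEC.
have walkL0 : walk eta psi (ArcL 0) = w 0%N by rewrite /w -conjE -rhoEC.
have walkL j : walk eta psi (ArcL j.+1) =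
    ((2 * sphi)%:C * (Num.sqrt (q j))%:C ^+ 2 - z) * - psi (ArcR j) +
    (2 * sphi)%:C * (Num.sqrt (p j))%:C * (Num.sqrt (q j))%:C * psi (ArcL j).
  by rewrite -etaE -rhoEC mulrN -mulNr.
split=> [ev|bal [j|[|j]]].
(* The left side factors as 2 sin(phi) sqrt(p_j) (sqrt(p_j) psi(j;L) - sqrt(q_j) psi(j;R)). *)
- have local j : z * psi (ArcL j) - w j = 0 ->
      (Num.sqrt (p j))%:C * psi (ArcL j) = (Num.sqrt (q j))%:C * psi (ArcR j).
    move=> e; apply: (mulfI (mulf_neq0 K0 (sp0 j))).
    by apply/eqP; rewrite -subr_eq0 -[X in _ == X]e /w; apply/eqP; ring.
  (* The coin condition at j makes the coin output at (j;R) equal to z psi(j;R). *)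
  have step j : (Num.sqrt (p j))%:C * psi (ArcL j) = (Num.sqrt (q j))%:C * psi (ArcR j) ->
      psi (ArcL j.+1) = psi (ArcR j).
    move=> e; apply: (mulfI eigenvalue_neq0).
    have := ev (ArcL j.+1); rewrite walkL => /eqP.
    rewrite subr_eq0 => /eqP ->; ring: e.
  have bal j : (Num.sqrt (p j))%:C * psi (ArcL j) = (Num.sqrt (q j))%:C * psi (ArcR j).
    elim: j => [|j IHj]; apply: local; first by rewrite -walkL0 ev.
    by rewrite -walkR (step _ IHj) ev.
  by move=> j; split; [exact: step | exact: bal].
- have [e1 _] := bal j; have [_ e2] := bal j.+1.
  rewrite walkR -e1 /w; ring: e2.
- have [_ e2] := bal 0%N; rewrite walkL0 /w; ring: e2.
- have [e1 e2] := bal j; rewrite walkL e1; ring: e2.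
Qed.

End Eigenvalue.

Theorem proposition3p1 (R : realType) (kappa : R) (eta : nat -> R[i])
  (eta_le1 : forall j, modulus (eta j) <= 1)
  (eta_Im : forall j, complex.Im (eta j) = kappa)
  (kappa_neq1 : kappa != 1) (kappa_neqN1 : kappa != - 1)
  (p : nat -> R) (p_def : p = prob_p kappa eta)
  (q : nat -> R) (q_def : q = prob_q kappa eta)
  (q_neq0 : forall j, (0 < j)%N -> q j != 0)
  (posrec : positive_recurrent (half_line_trans p q))
  (mV : nat -> R[i]) (mV_def : is_mV p q mV)
  (z : R[i]) (z_def : z = - (0 +i* 1) * expi (acos kappa)) :
  [/\ exists2 psi, walk_ker eta z psi & exists a, psi a != 0,
      l2 mV,
      walk_ker eta z = line (map_K p q mV)
    & q 0%N != 0 -> walk_ker eta z = line (psi_star p q)].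
Proof.
have p_ge0 j : 0 <= p j by rewrite p_def; exact: prob_p_ge0.
have q_ge0 j : 0 <= q j by rewrite q_def; exact: prob_q_ge0.
have pq1 j : p j + q j = 1 by rewrite p_def q_def; exact: prob_pq1.
have q_gt0 j : 0 < q j.+1 by rewrite lt_def q_neq0 /=.
have p_gt0 := positive_recurrent_p_gt0 _ _ p_ge0 q_ge0 pq1 q_gt0 posrec.
have [M piM] := reversible_measure_summable _ _ p_ge0 q_ge0 pq1 q_gt0 (posrec 0%N).
have pi_ge0 := reversible_measure_ge0 _ _ p_ge0 q_ge0.
have mVE := is_mVE _ _ _ mV_def.
have kerE : walk_ker eta z = [set psi | l2 psi /\ balanced p q psi].
  apply/seteqP; split => psi [l2psi]; rewrite z_def (eigenvalueE _ _ eta_le1 eta_Im)//;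
    rewrite p_def q_def => H; split=> //; apply/eigenfunction_balanced => //; by rewrite -p_def.
(* A multiple of Km_V is K applied to a multiple of m_V. *)
have l2Km c : l2 (fun a => c * map_K p q mV a).
  have -> : (fun a => c * map_K p q mV a) = map_K p q (fun j => c * mV j).
    by apply/funext => -[j|j]; rewrite /= mulrCA.
  apply: l2_map_K => [j|j|]; [have := pq1 j; have := q_ge0 j; have := p_ge0 j; lra..|].
  apply: (l2_mV p q (c * mV 0%N) _ M) => // j.
  by rewrite mVE mulrA.
have Kline : walk_ker eta z = line (map_K p q mV).
  rewrite -(balanced_line p q)//; [|exact: balanced_map_K|exact: map_K_neq0].
  (* A balanced function is automatically square summable, being a multiple of Km_V. *)
  rewrite kerE; apply/seteqP; split => psi /= => [[]//|bpsi]; split => //.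
  have : line (map_K p q mV) psi.
    by rewrite -(balanced_line p q)//; [exact: balanced_map_K|exact: map_K_neq0].
  by move=> [c _ <-].
split => //.
- exists (map_K p q mV); last by exists (ArcR 0); exact: map_K_neq0.
  by rewrite Kline; exists 1 => //; apply/funext => a; rewrite mul1r.
- exact: l2_mV pi_ge0 piM mVE.
(* Both lines equal the set of balanced functions; psi_*(0;R) = sqrt(p_0/q_0) is nonzero. *)
- move=> q0; rewrite Kline -!(balanced_line p q)//.
  + exact: balanced_psi_star.
  + rewrite (inj_eq (@complexI R) _ 0) sqrtr_eq0 -ltNge !big_nat1 divr_gt0//.
    by rewrite lt_neqAle eq_sym q0 q_ge0.
  + exact: balanced_map_K.
  + exact: map_K_neq0.
Qed.
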